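(* Let $k,f,\gamma_1,\gamma_2,\eta_1,\eta_2,\lambda,h_1,h_2$ satisfy assumptions $(C_1)$–$(C_6)$ listed in the context, and let $P$, $\|\cdot\|_\infty$ and $K$ be as defined there. Assume that there exist $\tau,\xi_1,\xi_2\in(0,+\infty)$ such that $$0\leq f(t,u,v)\leq\tau u\quad\text{for every }(t,u,v)\in[0,1]\times[0,\infty)^2,$$ $$h_i[u]\leq\xi_i\|u\|_\infty\quad\text{for every }u\in P\text{ and }i=1,2,$$ $$\lambda\tau K+\sum_{i=1}^{2}\eta_i\xi_i\gamma_i(1)<1.$$ Then the perturbed Hammerstein integral equation $$u(t)=\eta_1\gamma_1(t)h_1[u]+\eta_2\gamma_2(t)h_2[u]+\lambda\int_0^1 k(t,s)f(s,u(s),u'(s))\,ds,\qquad t\in[0,1],$$ has at most the zero solution in $P$ (that is, any solution $u\in P$ is identically zero).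
   Context: The space $C^1[0,1]$ of real-valued continuously differentiable functions on $[0,1]$ is endowed with the norm $\|u\|:=\max\{\|u\|_\infty,\|u'\|_\infty\}$, where $\|u\|_\infty:=\max_{t\in[0,1]}|u(t)|$. The cone of non-negative, non-decreasing functions is $$P:=\{u\in C^1[0,1]:\ u(t)\ge 0 \text{ and } u'(t)\ge 0\ \text{for every } t\in[0,1]\}.$$ Standing assumptions: $(C_1)$ $k:[0,1]\times[0,1]\to[0,+\infty)$ is measurable and continuous in $t$ for almost every (a.e.) $s$, that is, for every $\tau\in[0,1]$ we have $\lim_{t\to\tau}|k(t,s)-k(\tau,s)|=0$ for a.e. $s\in[0,1]$; furthermore there exists a function $\Phi\in L^1(0,1)$ such that $0\le k(t,s)\le\Phi(s)$ for $t\in[0,1]$ and a.e. $s\in[0,1]$. $(C_2)$ The partial derivative $\partial_t k(t,s)$ is non-negative and continuous in $t$ for a.e. $s$, and there exists $\Psi\in L^1(0,1)$ such that $0\le\partial_t k(t,s)\le\Psi(s)$ for $t\in[0,1]$ and a.e. $s\in[0,1]$. $(C_3)$ $f:[0,1]\times[0,+\infty)\times[0,+\infty)\to[0,+\infty)$ is continuous. $(C_4)$ $\gamma_1,\gamma_2\in C^1[0,1]$ and $\gamma_1(t),\gamma_2(t),\gamma_1'(t),\gamma_2'(t)\ge 0$ for every $t\in[0,1]$. $(C_5)$ $\eta_1,\eta_2,\lambda\in[0,+\infty)$. $(C_6)$ $h_1,h_2:P\to[0,+\infty)$ are (not necessarily linear) functionals which are continuous and map bounded sets into bounded sets; here $P$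 carries the metric induced by $\|\cdot\|$. Quantity: $K:=\int_0^1 k(1,s)\,ds$. *)

(* Defs.v *)
From HB Require Import structures.
From mathcomp Require Import all_boot all_order all_algebra.
From mathcomp Require Import all_classical all_reals all_analysis measurable_realfun.
Import Order.TTheory GRing.Theory Num.Theory.
Import numFieldNormedType.Exports.

Set Implicit Arguments.
Unset Strict Implicit.
Unset Printing Implicit Defensive.

Local Open Scope classical_set_scope.
Local Open Scope ring_scope.

(* Functions on [0,1] are represented by functions on R of which only the
   values on [0,1] are ever used. *)

Definition I01 (R : realType) : set R := `[0, 1].
Arguments I01 {R}.

(* Limits are taken inside [0,1], so derivatives are one-sided at 0 and 1. *)
Definition diffquo01 (R : realType) (u : R -> R) (t s : R) : R :=
  (u s - u t) / (s - t).

Definition derivable01 (R : realType) (u : R -> R) (t : R) : Prop :=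
  cvg (diffquo01 u t @ within I01 t^').

Definition deriv01 (R : realType) (u : R -> R) (t : R) : R :=
  lim (diffquo01 u t @ within I01 t^').

Definition C1_01 (R : realType) (u : R -> R) : Prop :=
  (forall t, I01 t -> derivable01 u t) /\
  {within I01, continuous (deriv01 u)}.

Definition supnorm (R : realType) (u : R -> R) : R :=
  sup [set `|u t| | t in I01].

Definition C1norm (R : realType) (u : R -> R) : R :=
  Num.max (supnorm u) (supnorm (deriv01 u)).

Definition coneP (R : realType) : set (R -> R) :=
  [set u | C1_01 u /\ forall t, I01 t -> 0 <= u t /\ 0 <= deriv01 u t].
Arguments coneP {R}.

(* Continuity is for the distance C1norm (v - u), which vanishes when u and v
   agree on [0,1]; hence on coneP the value h u depends only on the restriction
   of u to [0,1], i.e. h is a functional on the cone of C^1[0,1]. *)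
Definition continuous_on_coneP (R : realType) (h : (R -> R) -> R) : Prop :=
  forall u, coneP u -> forall e : R, 0 < e ->
    exists2 d : R, 0 < d &
      forall v, coneP v -> C1norm (v \- u) < d -> `|h v - h u| < e.

Definition bounded_on_coneP (R : realType) (h : (R -> R) -> R) : Prop :=
  forall A : set (R -> R), A `<=` coneP ->
    (exists M : R, forall u, A u -> C1norm u <= M) ->
    exists N : R, forall u, A u -> `|h u| <= N.

(* lebesgue_measure is only defined on Borel sets; the completed measure gives
   Lebesgue measurability and the Lebesgue integral. *)
Notation leb := completed_lebesgue_measure.

(* The sigma-algebra on the plane is the completion of the Borel one for the
   two-dimensional Lebesgue measure. *)
Definition lebesgue_measurable2 (R : realType) (D : set (R * R))
    (g : R * R -> R) : Prop :=
  forall Y : set R, measurable Y ->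
    completed_algebra_gen (@lebesgue_measure R \x @lebesgue_measure R)%E
      (D `&` g @^-1` Y).

(* Main.v *)
(* A solution u in the cone is non-decreasing, so its sup norm is u(1).
   Evaluating the equation at t = 1 and inserting f <= tau u <= tau u(1) and
   h_i[u] <= xi_i u(1) gives u(1) <= S u(1), where S < 1 is the constant of the
   smallness hypothesis; hence u(1) = 0 and u = 0. *)
Require Import Defs.
From HB Require Import structures.
From mathcomp Require Import all_boot all_order all_algebra.
From mathcomp Require Import all_classical all_reals all_analysis measurable_realfun.
From mathcomp Require Import ring.
Import Order.TTheory GRing.Theory Num.Theory.
Import numFieldNormedType.Exports.

Local Open Scope classical_set_scope.
Local Open Scope ring_scope.

(** Around an interior point small shifts stay in [0,1], so the limit within [I01] controls the
    two-sided one. This links [deriv01] to the usual derivative. *)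
Lemma cvg_shift_within01 (R : realType) (t : R) :
  0 < t < 1 -> h + t @[h --> (0 : R)^'] --> within I01 t^'.
Proof.
move=> /andP[t0 t1] A; rewrite !nbhs_simpl/= /within/= => -[e /= e0 eA].
(* The distances [t] and [1 - t] to the endpoints keep [h + t] inside [0,1]. *)
exists (Num.min e (Num.min t (1 - t))) => /=.
  by rewrite !lt_min e0 t0 subr_gt0.
move=> h /=; rewrite sub0r normrN !lt_min => /and3P[he ht h1] hN0.
apply: eA => /=.
- by rewrite opprD addrCA subrr addr0 normrN.
- by rewrite -subr_eq0 addrK.
- rewrite /I01/= in_itv/= -lerBlDr sub0r -lerBrDr.
  by move: ht h1; rewrite !ltr_norml => /andP[/ltW-> _] /andP[_ /ltW->].
Qed.

Lemma derivable01_cvg_derive (R : realType) (u : R -> R) (t : R) :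
  0 < t < 1 -> derivable01 u t ->
  h^-1 *: ((u \o shift t) (h *: 1) - u t) @[h --> (0 : R)^'] --> deriv01 u t.
Proof.
move=> t01 du.
have := cvg_comp _ _ (cvg_shift_within01 _ _ t01) du.
apply: cvg_trans; apply: near_eq_cvg; near=> h.
by rewrite /= /diffquo01 addrK mulrC /GRing.scale/= mulr1.
Unshelve. all: by end_near.
Qed.

Lemma derivable01_derivable (R : realType) (u : R -> R) (t : R) :
  0 < t < 1 -> derivable01 u t -> derivable u t 1.
Proof.
by move=> t01 /(derivable01_cvg_derive _ _ _ t01) du; apply/cvg_ex; exists (deriv01 u t).
Qed.

Lemma derivable01_derive1 (R : realType) (u : R -> R) (t : R) :
  0 < t < 1 -> derivable01 u t -> derive1 u t = deriv01 u t.
Proof.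
move=> t01 /(derivable01_cvg_derive _ _ _ t01) du.
by rewrite derive1E; apply: cvg_lim.
Qed.

(** For [s != t], u(s) is u(t) plus (s - t) times the difference quotient; the quotient converges
    and its factor tends to 0. This covers the endpoints too. *)
Lemma derivable01_continuous (R : realType) (u : R -> R) :
  (forall t, I01 t -> derivable01 u t) -> {within I01, continuous u}.
Proof.
move=> du; apply/subspace_continuousP => t It.
have c0 : (s - t) * diffquo01 u t s + u t @[s --> within I01 t^'] --> u t.
  rewrite -[X in _ --> X]add0r; apply: cvgD; last exact: cvg_cst.
  rewrite -[X in _ --> X](mul0r (deriv01 u t)); apply: cvgM; last exact: du.
  rewrite -(subrr t); apply: cvgB; last exact: cvg_cst.
  by apply: cvg_within_filter; exact: nbhs_dnbhs.
(* [c0] concerns only points other than [t]; the point [t] itself is settled by [Aut]. *)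
move=> A At; have := c0 A At; have Aut := nbhs_singleton At.
rewrite /= !nbhs_simpl /within /= => -[e /= e0 eA]; exists e => //= s ts Is.
have [->//|st] := eqVneq s t.
have := eA s ts st Is; rewrite /diffquo01 mulrC divfK ?subr_eq0//.
by rewrite subrK.
Qed.

(** Monotonicity from the sign of the derivative: two-sided derivatives are used only on the open
    interval, and continuity carries the bound to the endpoints. *)
Lemma coneP_le1 (R : realType) (u : R -> R) (t : R) :
  coneP u -> I01 t -> u t <= u 1.
Proof.
move=> [[du _] u0] It.
have oo (x : R) : x \in `]0, 1[%R -> 0 < x < 1 by rewrite in_itv.
have I (x : R) : 0 < x < 1 -> I01 x.
  by move=> /andP[/ltW x0 /ltW x1]; rewrite /I01/= in_itv/= x0.
apply: (@ger0_derive1_le_cc _ u 0 1).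
- by move=> x /oo x01; apply: derivable01_derivable; auto.
- move=> x /oo x01; rewrite derivable01_derive1; auto.
  by have [] := u0 x (I x x01).
- exact: derivable01_continuous.
- by [].
- by rewrite in_itv/= lexx ler01.
- by move: It; rewrite /I01/= in_itv/= => /andP[].
Qed.

Lemma coneP_supnorm_le1 (R : realType) (u : R -> R) :
  coneP u -> supnorm u <= u 1.
Proof.
move=> uP; apply: ge_sup.
  by exists `|u 0|, 0 => //; rewrite /I01/= in_itv/= lexx ler01.
move=> _ [t It <-]; have [_ /(_ t It)[ut _]] := uP.
by rewrite ger0_norm// coneP_le1.
Qed.

Section integral_without_measurability.
Import HBNNSimple.

(* The integral of a nonnegative function is the supremum of the integrals of
   the simple functions below it, and this makes sense without measurability.
   The sections k(1, .) are therefore handled without deriving their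
   measurability from the joint measurability of k. *)
Lemma ge0_ae_le_integral_simple d (T : measurableType d) (R : realType)
    (mu : {measure set T -> \bar R}) (D : set T) (f g : T -> \bar R) :
  measurable D -> measurable_fun D g ->
  (forall x, D x -> 0 <= f x)%E -> (forall x, D x -> 0 <= g x)%E ->
  {ae mu, forall x, D x -> (f x <= g x)%E} ->
  (\int[mu]_(x in D) f x <= \int[mu]_(x in D) g x)%E.
Proof.
move=> mD mg f0 g0 fg; rewrite ge0_integralE//.
apply: ge_ereal_sup => _ [h /= hf <-]; rewrite -integralT_nnsfun [leRHS]integral_mkcond.
(* The simple function [h] replaces [f] here, so both sides of the almost-everywhere comparison are
   measurable. *)
apply: ae_ge0_le_integral => //.
- by move=> x _; rewrite lee_fin.
- exact/measurable_EFinP.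
- by move=> x _; apply: erestrict_ge0.
- by apply/(measurable_restrictT _ mD).
apply: filterS fg => x fgx _; apply: le_trans (hf x) _.
by rewrite !patchE; case: ifPn => // /set_mem/fgx.
Qed.

(** Dividing a simple function below [f] by [c] yields a simple function below [g], so the constant
    comes out at the level of the suprema. *)
Lemma ge0_le_integralZl d (T : measurableType d) (R : realType)
    (mu : {measure set T -> \bar R}) (D : set T) (f g : T -> \bar R) (c : R) :
  0 < c ->
  (forall x, D x -> 0 <= f x)%E -> (forall x, D x -> 0 <= g x)%E ->
  (forall x, D x -> f x <= c%:E * g x)%E ->
  (\int[mu]_(x in D) f x <= c%:E * \int[mu]_(x in D) g x)%E.
Proof.
move=> c0 f0 g0 fg; rewrite ge0_integralE//.
apply: ge_ereal_sup => _ [h /= hf <-].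
have ci0 : 0 <= c^-1 by rewrite invr_ge0 ltW.
rewrite -lee_pdivrMl// -sintegralrM ge0_integralE//.
apply: ereal_sup_ubound => /=; exists (scale_nnsfun h ci0) => // x.
rewrite /= EFinM lee_pdivrMl//; apply: le_trans (hf x) _.
by rewrite !patchE; case: ifPn => [/set_mem/fg//|_]; rewrite mule0.
Qed.

End integral_without_measurability.

(** Domination by an integrable function. The bound is integrable on the open interval while the
    integral runs over the closed one; the endpoints form a null set. *)
Lemma leb_ge0_integral_lty (R : realType) (f g : R -> R) :
  (forall s, I01 s -> 0 <= f s) ->
  (@leb R).-integrable `]0, 1[ (EFin \o g) ->
  {ae (@leb R), forall s, I01 s -> f s <= g s} ->
  (\int[leb]_(s in I01) (f s)%:E < +oo)%E.
Proof.
move=> f0 ig fg.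
(* [leb] is carried by the Caratheodory sigma-algebra, which contains the Borel sets. *)
have mB (A : set R) : measurable A ->
    (@wlength R idfun)^*%mu.-cara.-measurable A.
  exact: sub_caratheodory.
(* The absolute value, extended by 0, is a non-negative majorant on the whole line with the same
   integral as |g| over the open interval. *)
pose G := (abse \o (EFin \o g)) \_ `]0, 1[ : R -> \bar R.
have mitv (i : interval R) :
    (@wlength R idfun)^*%mu.-cara.-measurable [set` i].
  by apply: mB; exact: measurable_itv.
have null0 (a : R) : {ae (@leb R), forall s, s != a}.
  exists [set a]; split; first by apply: mB; exact: measurable_set1.
    exact: lebesgue_measure_set1.
  by move=> s /= /negP; rewrite negbK => /eqP.
have /measurable_int mg := integrable_abse ig.
apply: (@le_lt_trans _ _ (\int[leb]_(s in I01) G s)%E).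
  apply: ge0_ae_le_integral_simple; first exact: mitv.
  - apply: (measurable_funS measurableT) => //.
    by apply/(measurable_restrictT _ (mitv _)).
  - by move=> s Is; rewrite lee_fin f0.
  - by move=> s _; apply: erestrict_ge0 => x _; exact: abse_ge0.
  have aeF : Filter (nbhs (almost_everywhere (@leb R))).
    exact: ae_filter_ringOfSetsType.
  apply: filterS3 (null0 0) (null0 1) fg => s s0 s1 fgs Is.
  have so : s \in `]0, 1[%classic.
    move: Is; rewrite inE /I01/= !in_itv/= => /andP[? ?].
    by rewrite !lt_neqAle eq_sym s0 s1; apply/andP.
  by rewrite /G patchE so/= lee_fin (le_trans (fgs Is))// ler_norm.
rewrite -integral_mkcondr (_ : _ `&` _ = `]0, 1[%classic); last first.
  by apply/setIidPr => s; rewrite /I01/= !in_itv/= => /andP[/ltW-> /ltW->].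
by have /integrableP[_] := ig.
Qed.

Theorem theorem2p3 (R : realType)
  (k : R -> R -> R) (f : R -> R -> R -> R) (gamma1 gamma2 : R -> R)
  (eta1 eta2 lambda : R) (h1 h2 : (R -> R) -> R)
  (k_ge0 : forall t s, I01 t -> I01 s -> 0 <= k t s)
  (k_meas : lebesgue_measurable2 (I01 `*` I01) (fun p => k p.1 p.2))
  (k_cont : forall tau, I01 tau -> {ae (@leb R), forall s, I01 s ->
     `|k t s - k tau s| @[t --> within I01 (nbhs tau)] --> (0 : R)})
  (k_bound : exists2 Phi : R -> R,
     (@leb R).-integrable `]0, 1[ (EFin \o Phi) &
     forall t, I01 t -> {ae (@leb R), forall s, I01 s -> 0 <= k t s <= Phi s})
  (dk_cont : forall tau, I01 tau -> {ae (@leb R), forall s, I01 s ->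
     [/\ (\forall t \near within I01 (nbhs tau), derivable01 (k^~ s) t),
         0 <= deriv01 (k^~ s) tau &
         deriv01 (k^~ s) t @[t --> within I01 (nbhs tau)]
           --> deriv01 (k^~ s) tau]})
  (dk_bound : exists2 Psi : R -> R,
     (@leb R).-integrable `]0, 1[ (EFin \o Psi) &
     forall t, I01 t -> {ae (@leb R), forall s, I01 s ->
       0 <= deriv01 (k^~ s) t <= Psi s})
  (f_ge0 : forall t u v, I01 t -> 0 <= u -> 0 <= v -> 0 <= f t u v)
  (f_cont : {within [set p : R * R * R | [/\ I01 p.1.1, 0 <= p.1.2 & 0 <= p.2]],
     continuous (fun p : R * R * R => f p.1.1 p.1.2 p.2)})
  (gamma1_C1 : C1_01 gamma1) (gamma2_C1 : C1_01 gamma2)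
  (gamma1_ge0 : forall t, I01 t -> 0 <= gamma1 t /\ 0 <= deriv01 gamma1 t)
  (gamma2_ge0 : forall t, I01 t -> 0 <= gamma2 t /\ 0 <= deriv01 gamma2 t)
  (eta1_ge0 : 0 <= eta1) (eta2_ge0 : 0 <= eta2) (lambda_ge0 : 0 <= lambda)
  (h1_ge0 : forall u, coneP u -> 0 <= h1 u)
  (h2_ge0 : forall u, coneP u -> 0 <= h2 u)
  (h1_cont : continuous_on_coneP h1) (h2_cont : continuous_on_coneP h2)
  (h1_bounded : bounded_on_coneP h1) (h2_bounded : bounded_on_coneP h2)
  (tau xi1 xi2 : R) (tau_gt0 : 0 < tau) (xi1_gt0 : 0 < xi1) (xi2_gt0 : 0 < xi2)
  (f_le : forall t u v, I01 t -> 0 <= u -> 0 <= v -> 0 <= f t u v <= tau * u)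
  (h1_le : forall u, coneP u -> h1 u <= xi1 * supnorm u)
  (h2_le : forall u, coneP u -> h2 u <= xi2 * supnorm u)
  (small : lambda * tau * (\int[leb]_(s in I01) k 1 s)
           + (eta1 * xi1 * gamma1 1 + eta2 * xi2 * gamma2 1) < 1) :
  forall u : R -> R, coneP u ->
    (forall t, I01 t ->
       u t = eta1 * gamma1 t * h1 u + eta2 * gamma2 t * h2 u
             + lambda * \int[leb]_(s in I01) (k t s * f s (u s) (deriv01 u s))) ->
    forall t, I01 t -> u t = 0.
Proof.
move=> u uP ueq t It.
have I1 : I01 (1 : R) by rewrite /I01/= in_itv/= ler01 lexx.
have u_ge0 s : I01 s -> 0 <= u s by have [_ u0] := uP; move=> /u0[].
have du_ge0 s : I01 s -> 0 <= deriv01 u s by have [_ u0] := uP; move=> /u0[].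
suff u1_le0 : u 1 <= 0.
  apply/eqP; rewrite eq_le u_ge0// andbT.
  exact: le_trans (coneP_le1 _ _ _ uP It) u1_le0.
rewrite leNgt; apply/negP => u1_gt0.
pose F s := k 1 s * f s (u s) (deriv01 u s).
have F_ge0 s : I01 s -> 0 <= F s.
  by move=> Is; rewrite mulr_ge0 ?k_ge0 ?f_ge0 ?u_ge0 ?du_ge0.
have F_le : \int[leb]_(s in I01) F s
    <= tau * u 1 * \int[leb]_(s in I01) k 1 s.
  have c_gt0 : 0 < tau * u 1 by rewrite mulr_gt0.
  (* The real integral is [fine] of the extended one, and [fine] sends infinity to 0; finiteness
     lets the comparison pass to real numbers. *)
  have kint_lty : (\int[leb]_(s in I01) (k 1 s)%:E < +oo)%E.
    have [Phi iPhi kPhi] := k_bound.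
    apply: leb_ge0_integral_lty iPhi _ => [s Is|]; first exact: k_ge0.
    have aeF : Filter (nbhs (almost_everywhere (@leb R))).
      exact: ae_filter_ringOfSetsType.
    by apply: filterS (kPhi 1 I1) => s ks /ks/andP[].
  have kint_ge0 : (0 <= \int[leb]_(s in I01) (k 1 s)%:E)%E.
    by apply: integral_ge0 => s Is; rewrite lee_fin k_ge0.
  have kint_fin : (\int[leb]_(s in I01) (k 1 s)%:E)%E \is a fin_num.
    by rewrite ge0_fin_numE.
  have Fint_le : (\int[leb]_(s in I01) (F s)%:E
      <= (tau * u 1)%:E * \int[leb]_(s in I01) (k 1 s)%:E)%E.
    apply: ge0_le_integralZl c_gt0 _ _ _ => s Is; rewrite lee_fin.
    - exact: F_ge0.
    - exact: k_ge0.
    - rewrite /F mulrC ler_wpM2r ?k_ge0//.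
      have /andP[_] := f_le s (u s) (deriv01 u s) Is (u_ge0 s Is) (du_ge0 s Is).
      by move=> /le_trans; apply; rewrite ler_pM2l// coneP_le1.
  (* Writing the constant as a [fine] turns the right side into [fine] of the bound in [Fint_le]. *)
  rewrite /Rintegral -[leRHS]/(fine (tau * u 1)%:E * _) -fineM//.
  apply: fine_le => //; last by rewrite fin_numM.
  rewrite ge0_fin_numE; last first.
    by apply: integral_ge0 => s Is; rewrite lee_fin F_ge0.
  by rewrite (le_lt_trans Fint_le)// -(fineK kint_fin) -EFinM ltry.
have h_le h xi : 0 < xi -> (forall v, coneP v -> h v <= xi * supnorm v) ->
    h u <= xi * u 1.
  move=> xi_gt0 /(_ u uP)/le_trans; apply.
  by rewrite ler_pM2l// coneP_supnorm_le1.
(* The equation at 1 is refuted by showing that its right side is strictly below [u 1]. *)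
have := ueq 1 I1; apply/eqP; rewrite gt_eqF//.
have [g1 _] := gamma1_ge0 1 I1; have [g2 _] := gamma2_ge0 1 I1.
(* Multiplying [small] by [u 1 > 0] keeps it strict; it remains to bound the right side by the
   constant of [small] times [u 1]. *)
have := small; rewrite -(ltr_pM2r u1_gt0) mul1r; apply: le_lt_trans.
have e1 : eta1 * gamma1 1 * h1 u <= eta1 * gamma1 1 * (xi1 * u 1).
  by rewrite ler_wpM2l ?mulr_ge0 ?h_le.
have e2 : eta2 * gamma2 1 * h2 u <= eta2 * gamma2 1 * (xi2 * u 1).
  by rewrite ler_wpM2l ?mulr_ge0 ?h_le.
have e3 := ler_wpM2l lambda_ge0 F_le.
apply: le_trans (lerD (lerD e1 e2) e3) _.
(* The three bounds add up to exactly that product. *)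
by rewrite le_eqVlt; apply/orP; left; apply/eqP; ring.
Qed.
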